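(* Let $(\Gamma,\mu)$ be a weighted graph satisfying $(p_0)$ with resolvent metric $\rho$, and assume the volume doubling property $(VD)_\rho$. Then there is a constant $C>0$ such that for all $x,y\in\Gamma$ and all integers $n>0$ $$p_n(x,x)\le\frac{C}{V_\rho(x,f(x,n))},$$ where $f(x,\cdot)$ is the inverse of $F(x,\cdot)$, $F(x,r)=\big(r^2V_\rho(x,r)\big)^{1/m}$, in the second variable, and furthermore $$p_n(x,y)\le\frac{C}{\sqrt{V_\rho(x,f(x,n))\,V_\rho(y,f(y,n))}} .$$
   Context: Weighted graph: $\Gamma$ is a countably infinite set, $\mu_{x,y}=\mu_{y,x}\ge 0$ symmetric weights, edges are the pairs with $\mu_{x,y}>0$, and the graph is connected. $\mu(x)=\sum_{y}\mu_{x,y}$, $\mu(A)=\sum_{z\in A}\mu(z)$. The random walk has one-step transition probabilities $P(x,y)=\mu_{x,y}/\mu(x)$; $P$ also denotes the operator $Pf(x)=\sum_yP(x,y)f(y)$. Condition $(p_0)$: there is $p_0>0$ with $P(x,y)\ge p_0$ whenever $\mu_{x,y}>0$. $P_n(x,y)$ are the $n$-step transition probabilities and $p_n(x,y)=P_n(x,y)/\mu(y)$. Resolvent metric: for an integer $m\ge1$ put $\mathcal E_m(f,g)=\big((I-P)^mf,g\big)_{\ell_2(\Gamma,\mu)}$, $\mathcal F_m=\{f\in\ell_2(\Gamma,\mu):\mathcal E_m(f,f)>0\}$, and $$R_m(x,y)=\sup\Big\{\tfrac{|f(x)-f(y)|^2}{\mathcal E_m(f,f)}: f\in\mathcal F_m,\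 f(x)\ne f(y)\Big\},\qquad R_m(x,x)=0 .$$ The integer $m\ge 1$ is fixed so that $R_m(x,y)<\infty$ for all $x,y$. $\rho$ is a fixed metric on $\Gamma$ with $c\rho^2(x,y)\le R_m(x,y)\le C\rho^2(x,y)$ for all $x,y$ and some constants $C>1>c>0$. $B_\rho(x,r)$ is the connected component (in the graph) containing $x$ of $\{y:\rho(x,y)<r\}$, and $V_\rho(x,r)=\mu(B_\rho(x,r))$. $(VD)_\rho$: there is $C_\rho>0$ with $V_\rho(x,2r)\le C_\rho V_\rho(x,r)$ for all $x\in\Gamma$, $r>0$. Since $F(x,\cdot)$ may jump, its inverse is understood as $f(x,t)=\inf\{r>0:F(x,r)\ge t\}$. *)

(* Defs.v *)
From HB Require Import structures.
From mathcomp Require Import all_boot all_order all_algebra.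
From mathcomp Require Import all_classical all_reals all_analysis.

Set Implicit Arguments.
Unset Strict Implicit.
Unset Printing Implicit Defensive.

Import Order.TTheory GRing.Theory Num.Theory.

Local Open Scope classical_set_scope.
Local Open Scope ring_scope.

(* Unordered sum of an absolutely summable real family; it is meaningful only
   when both [\esum]s are finite. *)
Definition rsum (R : realType) (T : choiceType) (f : T -> R) : R :=
  fine (\esum_(x in setT) (f^\+ x)%:E) - fine (\esum_(x in setT) (f^\- x)%:E).

Definition is_metric (R : realType) (T : Type) (rho : T -> T -> R) : Prop :=
  [/\ forall x y, 0 <= rho x y,
      forall x y, rho x y = 0 <-> x = y,
      forall x y, rho x y = rho y x &
      forall x y z, rho x z <= rho x y + rho y z].

Section WeightedGraph.
Context {R : realType} {T : countType}.
Variable mu : T -> T -> R.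

Definition edge : rel T := fun x y => 0 < mu x y.

Definition connected_in (A : set T) (x y : T) : Prop :=
  exists p : seq T,
    [/\ path edge x p, last x p = y & forall z, z \in x :: p -> A z].

(* The last clause, mu(x) < +oo, is what makes P(x,y) = mu_{x,y} / mu(x) a
   transition probability. *)
Definition weighted_graph : Prop :=
  [/\ infinite_set [set: T],
      forall x y, mu x y = mu y x,
      forall x y, 0 <= mu x y,
      forall x y, connected_in setT x y &
      forall x, (\esum_(y in setT) (mu x y)%:E < +oo)%E].

Definition vweight (x : T) : R := fine (\esum_(y in setT) (mu x y)%:E).

Definition mweight (A : set T) : \bar R := \esum_(z in A) (vweight z)%:E.

Definition P1 (x y : T) : R := mu x y / vweight x.

Definition cond_p0 : Prop :=
  exists2 p0 : R, 0 < p0 & forall x y, 0 < mu x y -> p0 <= P1 x y.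

Definition Pop (f : T -> R) : T -> R := fun x => rsum (fun y => P1 x y * f y).

Fixpoint Pn (n : nat) (x y : T) : R :=
  if n is k.+1 then rsum (fun z => P1 x z * Pn k z y) else (x == y)%:R.

Definition pn (n : nat) (x y : T) : R := Pn n x y / vweight y.

Definition ell2 : set (T -> R) :=
  [set f | (\esum_(x in setT) (f x ^+ 2 * vweight x)%:E < +oo)%E].

Definition inner2 (f g : T -> R) : R := rsum (fun x => f x * g x * vweight x).

Definition lapl (f : T -> R) : T -> R := fun x => f x - Pop f x.

Definition Em (m : nat) (f g : T -> R) : R := inner2 (iter m lapl f) g.

Definition Fm (m : nat) : set (T -> R) := [set f | ell2 f /\ 0 < Em m f f].

Definition Rm (m : nat) (x y : T) : \bar R :=
  if x == y then 0%E
  else ereal_sup [set (`|f x - f y| ^+ 2 / Em m f f)%:E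
                 | f in [set f | Fm m f /\ f x <> f y]].

Definition resolvent_metric (m : nat) (rho : T -> T -> R) : Prop :=
  is_metric rho /\
  exists c C : R, [/\ 0 < c, c < 1, 1 < C &
    forall x y, ((c * rho x y ^+ 2)%:E <= Rm m x y)%E /\
                (Rm m x y <= (C * rho x y ^+ 2)%:E)%E].

Variable rho : T -> T -> R.

Definition Brho (x : T) (r : R) : set T :=
  [set y | connected_in [set z | rho x z < r] x y].

(* Extended-real valued: finiteness of the balls is not assumed. *)
Definition Vrho (x : T) (r : R) : \bar R := mweight (Brho x r).

Definition volume_doubling : Prop :=
  exists2 Crho : R, 0 < Crho &
    forall x r, 0 < r -> (Vrho x (2 * r) <= Crho%:E * Vrho x r)%E.

Definition Fscale (m : nat) (x : T) (r : R) : \bar R :=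
  poweR ((r ^+ 2)%:E * Vrho x r)%E m%:R^-1.

Definition fscale (m : nat) (x : T) (t : R) : R :=
  inf [set r : R | 0 < r /\ (t%:E <= Fscale m x r)%E].

End WeightedGraph.

(* Main.v *)
Require Import Defs.
From HB Require Import structures.
From mathcomp Require Import all_boot all_order all_algebra.
From mathcomp Require Import all_classical all_reals all_analysis.
From mathcomp Require Import finmap ring lra zify.

(** The kernel is compared with a smoothed kernel.  Write [L = I - P],
    [S = I + P] and let [delta x] be the unit point mass at [x], as a density
    with respect to the weights, so that [pn n x y] is the value at [x] of
    [P^n (delta y)].  By Cauchy-Schwarz it suffices to bound
    [pn (2k) x x] for [k = n./2] ([pn_le_diag]), and that value is at most
    [a = f x] where [f = S^m P^(2k) (delta x)] ([smoothed_ge_pn]).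

    The energy of [f] decays.  The numbers [(L^j S^(j+m) P^(2n) d, d)], with
    [d = delta x], are nonnegative because [P] is a self-adjoint contraction
    ([inner_mixop_ge0]); since [I - P^2 = L S], passing from [j] to [j + 1]
    is differencing in [n], so they form a completely monotone array and the
    [m]-th difference at [2k] is at most [(m/k)^m] times the undifferenced
    value at [k] ([completely_monotone_decay]).  The energy
    [E_m(f,f) = (L^m S^(2m) P^(4k) d, d)] is exactly this [m]-th difference,
    whence [E_m(f,f) <= (2m/n)^m a] ([Em_smoothed_decay]).  The factor [S^m] is
    what makes this true for bipartite graphs, where [P^(2k) (delta x)] alone
    keeps the energy at the eigenvalue -1.

    The resolvent metric turns energy into oscillation: on the ball of radius
    [r] around [x], [(a - f y)^2 <= C r^2 E_m(f,f)] ([smoothed_resolvent]).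
    When [r] is below [fscale x n], the definition of the scale gives
    [r^2 V(x,r) < n^m], hence [(a - f y)^2 V(x,r) <= K a], which implies
    [a <= 2 f y + K / V(x,r)].  Summing over the ball, and using that [f] has
    total mass at most [2^m], gives [a V(x,r) <= 2^(m+1) + K]
    ([smoothed_diag_volume_le]).  Taking [r = fscale x n / 2] and doubling
    once yields the theorem.

    Because of (p_0) every vertex has finitely many neighbours, so all
    functions involved have finite support and only finite sums occur. *)

Set Implicit Arguments.
Unset Strict Implicit.
Unset Printing Implicit Defensive.

Import Order.TTheory GRing.Theory Num.Theory.

Local Open Scope classical_set_scope.
Local Open Scope ring_scope.

(** * Sums of finitely supported functions *)

Section FiniteSupport.
Variables (R : realType) (T : choiceType).
Implicit Types (f g : T -> R) (s : {fset T}).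

Definition supported s f := forall x, x \notin s -> f x = 0.
Definition finsupp f := exists s, supported s f.

Lemma supported_sub s s' f :
  {subset s <= s'} -> supported s f -> supported s' f.
Proof. by move=> ss' sf x xs'; apply: sf; apply: contra xs' => /ss'. Qed.

Lemma supported_common f g :
  finsupp f -> finsupp g -> exists s, supported s f /\ supported s g.
Proof.
move=> [s sf] [s' sg]; exists (s `|` s')%fset.
by split; [apply: supported_sub sf|apply: supported_sub sg] => x xs;
  rewrite inE xs ?orbT.
Qed.

Lemma esum_supported s f : (forall x, 0 <= f x) -> supported s f ->
  (\esum_(x in setT) (f x)%:E = (\sum_(x <- s) f x)%:E)%E.
Proof.
move=> f0 sf; rewrite -sumEFin (fsbig_seq _ _ (fset_uniq s)).
rewrite -esum_fset//; last by move=> *; rewrite lee_fin.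
rewrite [in RHS]esum_mkcond; apply: eq_esum => x _; case: ifPn => //.
by rewrite notin_setE/= => /negP/sf ->.
Qed.

Lemma rsum_supported s f : supported s f -> rsum f = \sum_(x <- s) f x.
Proof.
move=> sf; rewrite /rsum !(@esum_supported s)//=.
- rewrite -sumrB; apply: eq_bigr => x _.
  by rewrite -[RHS](congr1 (@^~ x) (funrposBneg f)).
- by move=> x xs; rewrite /funrneg sf// oppr0 maxxx.
- by move=> x xs; rewrite /funrpos sf// maxxx.
Qed.

Lemma le_sum_esum s f : (forall x, 0 <= f x) ->
  ((\sum_(x <- s) f x)%:E <= \esum_(x in setT) (f x)%:E)%E.
Proof.
move=> f0; rewrite -sumEFin (fsbig_seq _ _ (fset_uniq s)).
by apply: esum_ge; exists [set` s].
Qed.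

End FiniteSupport.

(** * Local structure of the weighted graph *)

Section Walk.
Variables (R : realType) (T : countType) (mu : T -> T -> R).
Hypothesis hmu : weighted_graph mu.
Hypothesis hp0 : cond_p0 mu.
Implicit Types (f g h : T -> R) (s : {fset T}).

Local Notation v := (vweight mu).
Local Notation P := (Pop mu).
Local Notation L := (lapl mu).
Local Notation inner := (inner2 mu).

Let muC x y : mu x y = mu y x. Proof. by case: hmu. Qed.
Let mu_ge0 x y : 0 <= mu x y. Proof. by case: hmu. Qed.

Lemma sum_le_vweight s x : \sum_(y <- s) mu x y <= v x.
Proof.
case: hmu => _ _ _ _ /(_ x) fin.
rewrite -lee_fin fineK; first exact: le_sum_esum.
by rewrite ge0_fin_numE// esum_ge0// => *; rewrite lee_fin.
Qed.

Lemma edge_invariant_const (A : Type) (F : T -> A) :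
  (forall x y, edge mu x y -> F x = F y) -> forall x y, F x = F y.
Proof.
move=> FE x y; case: hmu => _ _ _ /(_ x y)[p [pp <- _]] _.
elim: p x pp => //= z p IH x /andP[xz /IH <-]; exact: FE.
Qed.

Lemma exists_notin_fset s : exists x, x \notin s.
Proof.
case: hmu => inf _ _ _ _; apply: contrapT => all_in; apply: inf.
apply: sub_finite_set (finite_fset s) => x _ /=.
by apply: contrapT => /negP xs; apply: all_in; exists x.
Qed.

Lemma exists_neighbour x : exists y, 0 < mu x y.
Proof.
have [y] := exists_notin_fset [fset x]%fset; rewrite inE => yx.
case: hmu => _ _ _ /(_ x y)[[|z p] [/= ]] + + _ _.
  by move=> _ xy; rewrite xy eqxx in yx.
by move=> /andP[xz _] _; exists z.
Qed.

Lemma vweight_gt0 x : 0 < v x.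
Proof.
have [y xy] := exists_neighbour x; apply: lt_le_trans xy _.
by have := sum_le_vweight [fset y]%fset x; rewrite big_seq_fset1.
Qed.

Let v_ge0 x : 0 <= v x. Proof. exact/ltW/vweight_gt0. Qed.
Let v_neq0 x : v x != 0. Proof. by rewrite gt_eqF// vweight_gt0. Qed.

(** Each neighbour carries at least the fraction [p0] of the weight at [x], so
    there are at most [1 / p0] of them. *)
Lemma locally_finite x : exists s, supported s (mu x).
Proof.
case: hp0 => p0 p0_gt0 hP.
have [|inf] := pselect (finite_set [set y | 0 < mu x y]).
  move=> /finite_fsetP[s Es]; exists s => y ys.
  apply/eqP; rewrite eq_le mu_ge0 andbT leNgt; apply: contra ys => xy.
  by have : [set` s] y by rewrite -Es.
have c0 : 0 < p0 * v x by rewrite mulr_gt0// vweight_gt0.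
have [s sA cs] := infinite_set_fset (Num.truncn (v x / (p0 * v x))).+1 inf.
have : (#|` s|%:R * (p0 * v x) <= v x).
  apply: le_trans (sum_le_vweight s x); rewrite -sum1_size natr_sum.
  rewrite mulr_suml big_seq [leRHS]big_seq; apply: ler_sum => y ys.
  by rewrite mul1r -ler_pdivlMr ?vweight_gt0//; apply/hP/sA.
rewrite -ler_pdivlMr// => ?; exfalso.
have := truncnS_gt (v x / (p0 * v x)); rewrite ltNge => /negP; apply.
by apply: le_trans (_ : #|` s|%:R <= _); rewrite ?ler_nat.
Qed.

(** * The operators [P], [I - P], [I + P] and [P^2] *)

(** Local finiteness makes [P] linear on all functions, with no summability
    condition. *)
Lemma Pop_local x : exists s, forall f, P f x = \sum_(y <- s) P1 mu x y * f y.
Proof.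
have [s sx] := locally_finite x; exists s => f.
by apply: rsum_supported => y /sx; rewrite /P1 => ->; rewrite !mul0r.
Qed.

Lemma Pop_supported s f x :
  supported s f -> P f x = \sum_(y <- s) P1 mu x y * f y.
Proof. by move=> sf; apply: rsum_supported => y /sf ->; rewrite mulr0. Qed.

Lemma PopD f g : P (f \+ g) = P f \+ P g.
Proof.
apply/funext => x; have [s E] := Pop_local x; rewrite /= !E -big_split/=.
by apply: eq_bigr => y _; rewrite mulrDr.
Qed.

Lemma PopB f g : P (f \- g) = P f \- P g.
Proof.
apply/funext => x; have [s E] := Pop_local x; rewrite /= !E -sumrB.
by apply: eq_bigr => y _; rewrite mulrBr.
Qed.

Lemma Pop_ge0 f : (forall x, 0 <= f x) -> forall x, 0 <= P f x.
Proof.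
move=> f0 x; have [s ->] := Pop_local x; apply: sumr_ge0 => y _.
by rewrite mulr_ge0// divr_ge0.
Qed.

Lemma finsuppD f g : finsupp f -> finsupp g -> finsupp (f \+ g).
Proof.
move=> ff fg; have [s [sf sg]] := supported_common ff fg; exists s => x xs.
by rewrite /= sf// sg// addr0.
Qed.

Lemma finsuppB f g : finsupp f -> finsupp g -> finsupp (f \- g).
Proof.
move=> ff fg; have [s [sf sg]] := supported_common ff fg; exists s => x xs.
by rewrite /= sf// sg// subr0.
Qed.

Lemma finite_neighbourhood (r : seq T) :
  exists s, forall x y, y \in r -> x \notin s -> mu x y = 0.
Proof.
elim: r => [|z r [s IH]]; first by exists fset0.
have [sz Hz] := locally_finite z; exists (sz `|` s)%fset => x y.
rewrite !inE negb_or => /orP[/eqP ->|yr] /andP[xz xs]; last exact: IH.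
by rewrite muC Hz.
Qed.

Lemma finsupp_Pop f : finsupp f -> finsupp (P f).
Proof.
move=> [s sf]; have [s' H] := finite_neighbourhood s; exists s' => x xs'.
rewrite (Pop_supported _ sf) big_seq big1// => y ys.
by rewrite /P1 H// !mul0r.
Qed.

(** [I + P], the signless Laplacian. *)
Definition slapl f : T -> R := f \+ P f.
Definition Pop2 f : T -> R := P (P f).

Lemma finsupp_lapl f : finsupp f -> finsupp (L f).
Proof. by move=> ff; apply: (finsuppB ff); apply: finsupp_Pop. Qed.

Lemma finsupp_slapl f : finsupp f -> finsupp (slapl f).
Proof. by move=> ff; apply: (finsuppD ff); apply: finsupp_Pop. Qed.

Lemma finsupp_Pop2 f : finsupp f -> finsupp (Pop2 f).
Proof. by move=> ff; do 2!apply: finsupp_Pop. Qed.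

Lemma finsupp_iter (A : (T -> R) -> T -> R) n f :
  (forall f, finsupp f -> finsupp (A f)) -> finsupp f -> finsupp (iter n A f).
Proof. by move=> hA ff; elim: n => //= n; apply: hA. Qed.

Lemma lapl_slapl f : L (slapl f) = f \- Pop2 f.
Proof.
by rewrite /lapl /slapl PopD; apply/funext => x /=; rewrite /Pop2; ring.
Qed.

Lemma slapl_lapl f : slapl (L f) = L (slapl f).
Proof.
rewrite lapl_slapl /slapl [P (L f)](PopB f (P f)).
by apply/funext => x /=; rewrite /lapl addrA subrK.
Qed.

Lemma lapl_slaplC f : L (slapl f) = slapl (L f).
Proof. by rewrite slapl_lapl. Qed.

Lemma lapl_Pop f : L (P f) = P (L f).
Proof. by rewrite [P (L f)](PopB f (P f)). Qed.

Lemma slapl_Pop f : slapl (P f) = P (slapl f).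
Proof. by rewrite /slapl PopD. Qed.

Lemma Pop2_lapl f : Pop2 (L f) = L (Pop2 f).
Proof. by rewrite /Pop2 [P (L f)](PopB f (P f)) PopB. Qed.

Lemma Pop2_slapl f : Pop2 (slapl f) = slapl (Pop2 f).
Proof. by rewrite /Pop2 /slapl !PopD. Qed.

Lemma iter_commute (X : Type) (A B : X -> X) n :
  (forall x, A (B x) = B (A x)) -> forall x, iter n A (B x) = B (iter n A x).
Proof. by move=> AB x; elim: n => //= n ->. Qed.

Lemma iter_commute2 (X : Type) (A B : X -> X) n p :
  (forall x, A (B x) = B (A x)) ->
  forall x, iter n A (iter p B x) = iter p B (iter n A x).
Proof. by move=> AB x; elim: p => //= p <-; rewrite (iter_commute n AB). Qed.

(** * Self-adjointness *)

Lemma innerC f g : inner f g = inner g f.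
Proof. by congr rsum; apply/funext => x; rewrite (mulrC (f x)). Qed.

Lemma inner_supported s f g :
  supported s g -> inner f g = \sum_(x <- s) f x * g x * v x.
Proof. by move=> sg; apply: rsum_supported => x /sg ->; rewrite mulr0 mul0r. Qed.

Lemma innerDl f g h : finsupp h -> inner (f \+ g) h = inner f h + inner g h.
Proof.
move=> [s sh]; rewrite !(inner_supported _ sh) -big_split/=.
by apply: eq_bigr => x _; ring.
Qed.

Lemma innerBl f g h : finsupp h -> inner (f \- g) h = inner f h - inner g h.
Proof.
move=> [s sh]; rewrite !(inner_supported _ sh) -sumrB/=.
by apply: eq_bigr => x _; ring.
Qed.

Lemma inner_ge0 f : finsupp f -> 0 <= inner f f.
Proof.
move=> [s sf]; rewrite (inner_supported _ sf); apply: sumr_ge0 => x _.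
by rewrite mulr_ge0// -expr2 sqr_ge0.
Qed.

Lemma inner_eq0 f : finsupp f -> inner f f = 0 -> forall x, f x = 0.
Proof.
move=> [s sf]; rewrite (inner_supported _ sf) => /eqP.
rewrite psumr_eq0 => [/allP H x|x _]; last by rewrite mulr_ge0// -expr2 sqr_ge0.
have [xs|/sf//] := boolP (x \in s).
have := H x xs.
by rewrite /= mulf_eq0 (negbTE (v_neq0 x)) orbF mulf_eq0 orbb => /eqP.
Qed.

(** Cauchy-Schwarz, from Lagrange's identity for the difference of the two
    sides. *)
Lemma inner_CS f g : finsupp f -> finsupp g ->
  inner f g ^+ 2 <= inner f f * inner g g.
Proof.
move=> ff fg; have [s [sf sg]] := supported_common ff fg.
rewrite !(inner_supported _ sf) !(inner_supported _ sg) -subr_ge0.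
suff -> : (\sum_(x <- s) f x * f x * v x) * (\sum_(x <- s) g x * g x * v x) -
    (\sum_(x <- s) f x * g x * v x) ^+ 2 =
  2^-1 * \sum_(x <- s) \sum_(y <- s) (f x * g y - f y * g x) ^+ 2 * v x * v y.
  rewrite mulr_ge0 ?invr_ge0//; do 2!apply: sumr_ge0 => ? _.
  by rewrite -mulrA mulr_ge0 ?sqr_ge0// mulr_ge0.
set A := \sum_(x <- s) f x * f x * v x.
set B := \sum_(x <- s) g x * g x * v x.
set D := \sum_(x <- s) f x * g x * v x.
transitivity (2^-1 * ((A * B + B * A) - 2 * (D * D))); first by field.
rewrite {1 2}/A {1 2}/B {1 2}/D !big_distrlr/= mulr_sumr -big_split -sumrB/=.
congr (_ * _); apply: eq_bigr => x _; rewrite mulr_sumr -big_split -sumrB/=.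
by apply: eq_bigr => y _; ring.
Qed.

Lemma inner_Pop_supported s f g : supported s f -> supported s g ->
  inner (P f) g = \sum_(x <- s) \sum_(y <- s) mu x y * f y * g x.
Proof.
move=> sf sg; rewrite (inner_supported _ sg); apply: eq_bigr => x _.
rewrite (Pop_supported _ sf) !mulr_suml; apply: eq_bigr => y _.
by rewrite /P1; field; apply: v_neq0.
Qed.

Lemma inner_Pop f g : finsupp f -> finsupp g -> inner (P f) g = inner f (P g).
Proof.
move=> ff fg; have [s [sf sg]] := supported_common ff fg.
rewrite (inner_Pop_supported sf sg) innerC (inner_Pop_supported sg sf).
rewrite exchange_big/=; apply: eq_bigr => x _; apply: eq_bigr => y _.
by rewrite muC mulrAC.
Qed.

(** Preservation of finite support is part of the notion so that it is stable
    under iteration. *)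
Definition symmetric_op (A : (T -> R) -> T -> R) :=
  forall f g, finsupp f -> finsupp g ->
    finsupp (A f) /\ inner (A f) g = inner f (A g).

Lemma sym_Pop : symmetric_op P.
Proof. by move=> f g ff fg; split; [apply: finsupp_Pop|apply: inner_Pop]. Qed.

Lemma sym_Pop2 : symmetric_op Pop2.
Proof.
move=> f g ff fg; split; first exact: finsupp_Pop2.
by rewrite /Pop2 !inner_Pop//; apply: finsupp_Pop.
Qed.

Lemma sym_lapl : symmetric_op L.
Proof.
move=> f g ff fg; split; first exact: finsupp_lapl.
rewrite [RHS]innerC !(innerBl _ (P _))//.
by rewrite inner_Pop// [inner g f]innerC [inner (P g) f]innerC.
Qed.

Lemma sym_slapl : symmetric_op slapl.
Proof.
move=> f g ff fg; split; first exact: finsupp_slapl.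
rewrite [RHS]innerC !(innerDl _ (P _))//.
by rewrite inner_Pop// [inner g f]innerC [inner (P g) f]innerC.
Qed.

Lemma sym_iter A n : symmetric_op A -> symmetric_op (iter n A).
Proof.
move=> sA; elim: n => [//|n IH] f g ff fg.
have [fA _] := IH _ _ ff fg; split; first by have [] := sA _ _ fA fA.
rewrite iterS (sA _ _ fA fg).2 iterSr (IH _ _ ff _).2//.
by have [] := sA _ _ fg fg.
Qed.

(** * Positivity of the spectrum of [I - P] and [I + P] *)

(** Used with [e = 1] and [e = -1], this is the Dirichlet form of [I + P] or
    [I - P]; the first sum accounts for the edges leaving [s]. *)
Lemma quadratic_form s h (e : R) : e ^+ 2 = 1 -> supported s h ->
  inner h h + e * inner (P h) h =
    \sum_(x <- s) (v x - \sum_(y <- s) mu x y) * h x ^+ 2 +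
    2^-1 * \sum_(x <- s) \sum_(y <- s) mu x y * (h x + e * h y) ^+ 2.
Proof.
move=> e1 sh; rewrite (inner_supported _ sh) (inner_Pop_supported sh sh).
set W := \sum_(x <- s) \sum_(y <- s) _ * _ ^+ 2.
have -> : W = 2 * \sum_(x <- s) \sum_(y <- s) mu x y * h x ^+ 2
            + 2 * e * \sum_(x <- s) \sum_(y <- s) mu x y * h y * h x.
  rewrite mulr_natl mulr2n {2}exchange_big/= -big_split mulr_sumr -big_split/=.
  apply: eq_bigr => x _; rewrite -big_split mulr_sumr -big_split/=.
  apply: eq_bigr => y _; rewrite [mu y x]muC.
  by rewrite sqrrD exprMn e1; ring.
have -> : \sum_(x <- s) (v x - \sum_(y <- s) mu x y) * h x ^+ 2 =
    \sum_(x <- s) h x * h x * v x - \sum_(x <- s) \sum_(y <- s) mu x y * h x ^+ 2.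
  rewrite -sumrB; apply: eq_bigr => x _; rewrite mulrBl mulr_suml.
  by congr (_ - _); rewrite expr2 mulrC.
set A := \sum_(x <- s) h x * h x * v x; set B := \sum_(x <- s) \sum_(y <- s) _.
by set D := \sum_(x <- s) _; clearbody A B D W; field.
Qed.

Lemma quadratic_form_ge0 h (e : R) : e ^+ 2 = 1 -> finsupp h ->
  0 <= inner h h + e * inner (P h) h.
Proof.
move=> e1 [s sh]; rewrite (quadratic_form e1 sh) addr_ge0//.
  by apply: sumr_ge0 => x _; rewrite mulr_ge0 ?sqr_ge0// subr_ge0 sum_le_vweight.
rewrite mulr_ge0 ?invr_ge0//; do 2!apply: sumr_ge0 => ? _.
by rewrite mulr_ge0 ?sqr_ge0.
Qed.

Lemma inner_lapl_ge0 h : finsupp h -> 0 <= inner (L h) h.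
Proof.
move=> fh; rewrite innerBl// -[- _]mulN1r.
by apply: quadratic_form_ge0; rewrite ?sqrrN ?expr1n.
Qed.

Lemma inner_slapl_ge0 h : finsupp h -> 0 <= inner (slapl h) h.
Proof.
move=> fh; rewrite innerDl// -[inner (P h) h]mul1r.
by apply: quadratic_form_ge0; rewrite ?expr1n.
Qed.

(** Contractivity of [P], from the identity
    [2 (I - P) (I + P) = (I - P) (I + P)^2 + (I + P) (I - P)^2]. *)
Lemma inner_lapl_slapl_ge0 h : finsupp h -> 0 <= inner (L (slapl h)) h.
Proof.
move=> fh; have fS := finsupp_slapl fh; have fL := finsupp_lapl fh.
have fLS := finsupp_lapl fS.
have : 0 <= inner (L (slapl h)) (slapl h) + inner (slapl (L h)) (L h).
  by apply: addr_ge0; [exact: inner_lapl_ge0|exact: inner_slapl_ge0].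
rewrite slapl_lapl ![inner (L (slapl h)) _]innerC -(innerDl _ _ fLS).
have -> : slapl h \+ L h = h \+ h.
  by apply/funext => x; rewrite /slapl /lapl/= addrACA subrr addr0.
by rewrite (innerDl _ _ fLS) -mulr2n pmulrn_lge0.
Qed.

(** Every operator below is such a word; as the factors commute, fixing their
    order loses nothing. *)
Definition mixop i j n h : T -> R := iter i L (iter j slapl (iter n Pop2 h)).

Lemma mixop_lapl i j n h : mixop i.+1 j n h = mixop i j n (L h).
Proof.
rewrite /mixop iterSr; congr iter.
by rewrite (iter_commute _ Pop2_lapl) (iter_commute _ slapl_lapl).
Qed.

Lemma mixop_slapl i j n h : mixop i j.+1 n h = mixop i j n (slapl h).
Proof. by rewrite /mixop iterSr (iter_commute _ Pop2_slapl). Qed.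

Lemma mixop_Pop2 i j n h : mixop i j n.+1 h = mixop i j n (Pop2 h).
Proof. by rewrite /mixop iterSr. Qed.

Lemma mixop_commute A i j n :
  (forall f, L (A f) = A (L f)) -> (forall f, slapl (A f) = A (slapl f)) ->
  (forall f, Pop2 (A f) = A (Pop2 f)) ->
  forall f, mixop i j n (A f) = A (mixop i j n f).
Proof.
move=> LA SA QA f.
by rewrite /mixop (iter_commute _ QA) (iter_commute _ SA) (iter_commute _ LA).
Qed.

Lemma finsupp_mixop i j n h : finsupp h -> finsupp (mixop i j n h).
Proof.
move=> fh; apply: (finsupp_iter _ finsupp_lapl).
by apply: (finsupp_iter _ finsupp_slapl); apply: (finsupp_iter _ finsupp_Pop2).
Qed.

Lemma inner_mixop_square A i j n h : symmetric_op A ->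
  (forall f, L (A f) = A (L f)) -> (forall f, slapl (A f) = A (slapl f)) ->
  (forall f, Pop2 (A f) = A (Pop2 f)) -> finsupp h ->
  inner (mixop i j n (A (A h))) h = inner (mixop i j n (A h)) (A h).
Proof.
move=> sA LA SA QA fh; rewrite (mixop_commute _ _ _ LA SA QA).
have [fA _] := sA _ _ fh fh; exact: (sA _ _ (finsupp_mixop i j n fA) fh).2.
Qed.

(** The symbol [(1 - t)^i (1 + t)^j t^(2n)] is nonnegative on the interval from
    -1 to 1, which contains the spectrum of [P].  The proof moves squares of
    [P], [I - P] and [I + P] evenly to both sides of the inner product, which
    leaves exponents [i, j <= 1] and [n = 0]. *)
Lemma inner_mixop_ge0 i j n h : finsupp h -> 0 <= inner (mixop i j n h) h.
Proof.
elim: n h => [|n IH] h fh; last first.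
  rewrite mixop_Pop2 (inner_mixop_square _ _ _ sym_Pop lapl_Pop slapl_Pop)//.
  by apply: IH; apply: finsupp_Pop.
have [l] := ubnP (i + j); elim: l i j h fh => // l IH i j h fh ij.
case: i ij => [|[|i]] ij; last first.
- rewrite !mixop_lapl (inner_mixop_square _ _ _ sym_lapl _ slapl_lapl Pop2_lapl)//.
  by apply: IH; [exact: finsupp_lapl|lia].
- case: j ij => [|[|j]] ij.
  + exact: inner_lapl_ge0.
  + exact: inner_lapl_slapl_ge0.
  + rewrite !mixop_slapl (inner_mixop_square _ _ _ sym_slapl lapl_slaplC _ Pop2_slapl)//.
    by apply: IH; [exact: finsupp_slapl|lia].
- case: j ij => [|[|j]] ij.
  + exact: inner_ge0.
  + exact: inner_slapl_ge0.
  + rewrite !mixop_slapl (inner_mixop_square _ _ _ sym_slapl lapl_slaplC _ Pop2_slapl)//.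
    by apply: IH; [exact: finsupp_slapl|lia].
Qed.

(** * Non-degeneracy of the energy *)

(** A function of zero Dirichlet energy is constant along edges, hence constant
    by connectedness, hence zero since the graph is infinite. *)
Lemma inner_lapl_eq0 h : finsupp h -> inner (L h) h = 0 -> forall x, h x = 0.
Proof.
move=> fh; rewrite (innerBl _ (P h) fh) -[- inner _ _]mulN1r => E0.
suff hE x y : edge mu x y -> h x = h y.
  move=> x; have [s sh] := fh; have [z zs] := exists_notin_fset s.
  by rewrite (edge_invariant_const hE x z) sh.
move=> xy; have [s0 sh0] := fh.
(* The support is enlarged so that the edge from x to y occurs in the sum. *)
have /supported_sub/(_ sh0) sh : {subset s0 <= ([fset x; y] `|` s0)%fset}.
  by move=> z zs; rewrite !inE zs orbT.
move: E0; rewrite (quadratic_form _ sh) ?sqrrN ?expr1n//.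
set s := (_ `|` _)%fset.
have pos1 : 0 <= \sum_(x <- s) (v x - \sum_(y <- s) mu x y) * h x ^+ 2.
  by apply: sumr_ge0 => z _; rewrite mulr_ge0 ?sqr_ge0// subr_ge0 sum_le_vweight.
have pos3 z w : 0 <= mu z w * (h z + -1 * h w) ^+ 2 by rewrite mulr_ge0 ?sqr_ge0.
have pos2 z : 0 <= \sum_(w <- s) mu z w * (h z + -1 * h w) ^+ 2.
  exact: sumr_ge0.
move=> /eqP; rewrite paddr_eq0// ?mulr_ge0 ?invr_ge0 ?sumr_ge0// => /andP[_].
rewrite mulf_eq0 invr_eq0 pnatr_eq0/= psumr_eq0// => /allP/(_ x).
rewrite !inE eqxx/= psumr_eq0// => /(_ isT)/allP/(_ y).
rewrite !inE eqxx orbT/= => /(_ isT); rewrite mulf_eq0 gt_eqF//= sqrf_eq0 mulN1r.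
by rewrite subr_eq0 => /eqP.
Qed.

Lemma inner_iter_lapl_eq0 i h : finsupp h ->
  inner (iter i L h) h = 0 -> forall x, h x = 0.
Proof.
have [l] := ubnP i; elim: l i h => // l IH [|[|i]] h il fh.
- exact: inner_eq0.
- exact: inner_lapl_eq0.
have fL := finsupp_lapl fh.
have -> : iter i.+2 L h = mixop i 0 0 (L (L h)) by rewrite -!mixop_lapl.
rewrite (inner_mixop_square _ _ _ sym_lapl _ slapl_lapl Pop2_lapl)// => E0.
apply: inner_lapl_eq0 => //.
have L0 : L h = fun=> 0.
  by apply/funext => x; apply: (IH i) => //; apply: ltnW.
by rewrite L0 innerC (inner_supported _ (s := fset0))// big_seq_fset0.
Qed.

(** * The transition density on the diagonal *)

(** The point mass at [x], as a density: it represents evaluation at [x] for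
    the inner product. *)
Definition delta (x : T) : T -> R := fun y => (y == x)%:R / v x.

Lemma supported_delta x : supported [fset x]%fset (delta x).
Proof. by move=> y; rewrite inE /delta => /negbTE ->; rewrite mul0r. Qed.

Lemma finsupp_delta x : finsupp (delta x).
Proof. by exists [fset x]%fset; apply: supported_delta. Qed.

Lemma delta_ge0 x y : 0 <= delta x y.
Proof. by rewrite divr_ge0. Qed.

Lemma inner_delta f x : inner f (delta x) = f x.
Proof.
rewrite (inner_supported _ (@supported_delta x)) big_seq_fset1 /delta eqxx.
by rewrite mulrA mulr1 divfK.
Qed.

Lemma pn_iter n x y : pn mu n x y = iter n P (delta y) x.
Proof.
elim: n x => [//|n IH] x.
have [s E] := Pop_local x; rewrite [RHS]/= E /pn [Pn _ _ _ _](E (Pn mu n ^~ y)).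
by rewrite mulr_suml; apply: eq_bigr => z _; rewrite -IH mulrA.
Qed.

Lemma iter_Pop2 n f : iter n Pop2 f = iter n.*2 P f.
Proof. by elim: n => // n IH; rewrite doubleS !iterS -IH. Qed.

Lemma pn_even k x y : pn mu k.*2 x y = inner (mixop 0 0 k (delta y)) (delta x).
Proof. by rewrite inner_delta pn_iter -iter_Pop2. Qed.

Lemma pn_ge0 n x y : 0 <= pn mu n x y.
Proof.
rewrite pn_iter; elim: n x => [|n IH] x; [exact: delta_ge0|exact: Pop_ge0].
Qed.

Lemma inner_iter_Pop n l x y :
  inner (iter n P (delta y)) (iter l P (delta x)) = pn mu (n + l) x y.
Proof.
have fy := finsupp_iter n finsupp_Pop (finsupp_delta y).
rewrite -(sym_iter l sym_Pop fy (finsupp_delta x)).2.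
by rewrite inner_delta -iterD addnC pn_iter.
Qed.

Lemma pn_even_decr k x : pn mu k.+1.*2 x x <= pn mu k.*2 x x.
Proof.
have fd := finsupp_delta x.
rewrite !pn_even -subr_ge0 -(innerBl _ _ fd).
have -> : mixop 0 0 k (delta x) \- mixop 0 0 k.+1 (delta x) =
  mixop 1 1 k (delta x) by rewrite /mixop/= lapl_slapl.
exact: inner_mixop_ge0.
Qed.

(** Split [n] as [n./2] plus the rest and apply Cauchy-Schwarz; if [n] is odd the
    longer half is shortened by monotonicity of the even return densities. *)
Lemma pn_le_diag n x y :
  pn mu n x y ^+ 2 <= pn mu n./2.*2 x x * pn mu n./2.*2 y y.
Proof.
have fd z i := finsupp_iter i finsupp_Pop (finsupp_delta z).
have {1}-> : n = (n - n./2 + n./2)%N by rewrite subnK// -divn2 leq_div.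
rewrite -inner_iter_Pop; apply: le_trans (inner_CS (fd y _) (fd x _)) _.
rewrite !inner_iter_Pop !addnn [leLHS]mulrC ler_wpM2l ?pn_ge0//.
have -> : (n - n./2 = n./2 + odd n)%N by rewrite -{1}(odd_double_half n); lia.
by case: odd; rewrite ?addn0// addn1 pn_even_decr.
Qed.

(** * The smoothed kernel and the decay of its energy *)

(** Here [u j] is the [j]-th difference of the sequence [u 0].  Each difference is
    nonnegative and nonincreasing, so [s + 1] times its value at [n + s] is at
    most a telescoping sum of the previous difference, started at [n]. *)
Lemma completely_monotone_decay (u : nat -> nat -> R) (s : nat) :
  (forall j n, 0 <= u j n) -> (forall j n, u j n - u j n.+1 = u j.+1 n) ->
  forall j n, s.+1%:R ^+ j * u j (n + j * s)%N <= u 0%N n.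
Proof.
move=> u0 uS.
have decr j n i : u j (n + i)%N <= u j n.
  elim: i => [|i IH]; first by rewrite addn0.
  by apply: le_trans IH; rewrite addnS -subr_ge0 uS.
have step j n : s.+1%:R * u j.+1 (n + s)%N <= u j n.
  have H t : (t <= s.+1)%N ->
      t%:R * u j.+1 (n + s)%N <= u j n - u j (n + t)%N.
    elim: t => [|t IH] ts; first by rewrite mul0r addn0 subrr.
    have {}IH := IH (ltnW ts).
    have := decr j.+1 (n + t)%N (s - t)%N; rewrite -addnA subnKC// => D.
    have := uS j (n + t)%N; rewrite -addnS => E.
    by rewrite -natr1 mulrDl mul1r; lra.
  by apply: le_trans (H _ (leqnn _)) _; rewrite lerBlDr lerDl.
elim=> [|j IH] n; first by rewrite expr0 mul1r mul0n addn0.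
apply: le_trans (IH n); rewrite exprSr -mulrA ler_wpM2l ?exprn_ge0//.
by rewrite mulSnr addnA.
Qed.

(** The factor [(I + P)^m] damps the spectrum near -1, where the energy of
    [P^(2k) (delta x)] does not decay. *)
Definition smoothed m k x : T -> R := mixop 0 m k (delta x).

Lemma finsupp_smoothed m k x : finsupp (smoothed m k x).
Proof. exact/finsupp_mixop/finsupp_delta. Qed.

Lemma smoothed_ge_pn m k x y : pn mu k.*2 y x <= smoothed m k x y.
Proof.
rewrite /smoothed/mixop/= iter_Pop2 pn_iter.
have g0 z : 0 <= iter k.*2 P (delta x) z by rewrite -pn_iter pn_ge0.
elim: m y => //= m IH y.
apply: le_trans (IH y) _; rewrite /slapl/= lerDl; apply: Pop_ge0 => z.
exact: le_trans (IH z).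
Qed.

Lemma smoothed_ge0 m k x y : 0 <= smoothed m k x y.
Proof. exact: le_trans (pn_ge0 _ _ _) (smoothed_ge_pn _ _ _ _). Qed.

Lemma Em_smoothed m k x : Em mu m (smoothed m k x) (smoothed m k x) =
  inner (mixop m (m + m) (k + k) (delta x)) (delta x).
Proof.
have fd := finsupp_delta x; have fs := finsupp_smoothed m k x.
rewrite /Em {2}/smoothed /mixop/=.
have fL := finsupp_iter m finsupp_lapl fs.
have fQ := finsupp_iter k finsupp_Pop2 fd.
rewrite -(sym_iter m sym_slapl fL fQ).2.
have [fS _] := sym_iter m sym_slapl fL fQ.
rewrite -(sym_iter k sym_Pop2 fS fd).2.
apply: (congr1 (inner ^~ (delta x))).
rewrite /smoothed /mixop !iterD.
rewrite (iter_commute2 _ _ Pop2_slapl) (iter_commute2 _ _ Pop2_lapl).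
by rewrite (iter_commute2 _ _ Pop2_slapl) (iter_commute2 _ _ slapl_lapl).
Qed.

(** * Mass *)

Definition mass f := inner f (fun=> 1).

Lemma mass_supported s f : supported s f -> mass f = \sum_(x <- s) f x * v x.
Proof.
move=> sf; rewrite /mass innerC (inner_supported _ sf).
by apply: eq_bigr => x _; rewrite mul1r.
Qed.

(** The weights are symmetric, so the mass sent out by a vertex is at most its
    own mass. *)
Lemma mass_Pop_le f : finsupp f -> (forall x, 0 <= f x) -> mass (P f) <= mass f.
Proof.
move=> ff f0; have [s [sf sP]] := supported_common ff (finsupp_Pop ff).
rewrite (mass_supported sf) (mass_supported sP).
rewrite (eq_bigr (fun x => \sum_(y <- s) mu x y * f y)) => [|x _]; last first.
  rewrite (Pop_supported _ sf) mulr_suml; apply: eq_bigr => y _.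
  by rewrite /P1; field; apply: v_neq0.
rewrite exchange_big/=; apply: ler_sum => y _.
rewrite -mulr_suml mulrC ler_wpM2l//.
by under eq_bigr do rewrite muC; apply: sum_le_vweight.
Qed.

Lemma mass_slapl_le f : finsupp f -> (forall x, 0 <= f x) ->
  mass (slapl f) <= 2 * mass f.
Proof.
move=> ff f0; have [s [sf sP]] := supported_common ff (finsupp_Pop ff).
have sS : supported s (slapl f) by move=> x xs; rewrite /slapl/= sf// sP// addr0.
rewrite mulr_natl mulr2n; apply: le_trans (lerD (lexx _) (mass_Pop_le ff f0)).
rewrite (mass_supported sf) (mass_supported sP) (mass_supported sS).
by rewrite -big_split/=; apply: ler_sum => x _; rewrite /slapl/= mulrDl.
Qed.

Lemma mass_smoothed_le m k x : mass (smoothed m k x) <= 2 ^+ m.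
Proof.
have fd := finsupp_delta x.
have g0 n y : 0 <= iter n P (delta x) y by rewrite -pn_iter pn_ge0.
rewrite /smoothed /mixop/= iter_Pop2.
elim: m => [|m IH].
  rewrite expr0; elim: k.*2 => [|n IH].
    rewrite (mass_supported (@supported_delta x)) big_seq_fset1 /delta eqxx.
    by rewrite divfK.
  apply: le_trans IH; apply: mass_Pop_le; first exact: finsupp_iter finsupp_Pop fd.
  exact: g0.
rewrite exprS iterS; have le2 := ler_wpM2l (ler0n R 2) IH.
apply: (le_trans _ le2); apply: mass_slapl_le => [|y].
  by apply: (finsupp_iter _ finsupp_slapl); apply: finsupp_iter finsupp_Pop fd.
by have := smoothed_ge0 m k x y; rewrite /smoothed /mixop/= iter_Pop2.
Qed.

Lemma sum_le_mass s f : finsupp f -> (forall x, 0 <= f x) ->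
  \sum_(x <- s) f x * v x <= mass f.
Proof.
move=> [s' sf] f0; have fv0 x : 0 <= f x * v x by rewrite mulr_ge0.
have sfv : supported s' (fun x => f x * v x) by move=> x /sf ->; rewrite mul0r.
rewrite (mass_supported sf) -lee_fin -(esum_supported fv0 sfv).
exact: le_sum_esum.
Qed.

(** * Energy and oscillation of the smoothed kernel *)

(** The energy of the smoothed kernel is the [m]-th difference, at time [2k], of
    the sequence whose value at time [k] is [smoothed m k x x]. *)
Lemma Em_smoothed_decay m k (s : nat) x : (m * s <= k)%N ->
  s.+1%:R ^+ m * Em mu m (smoothed m k x) (smoothed m k x) <= smoothed m k x x.
Proof.
move=> sk; have fd := finsupp_delta x.
pose u j n := inner (mixop j (j + m) n (delta x)) (delta x).
have u0 j n : 0 <= u j n by apply: inner_mixop_ge0.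
have uS j n : u j n - u j n.+1 = u j.+1 n.
  rewrite /u -(innerBl _ _ fd) mixop_Pop2.
  rewrite (mixop_commute _ _ _ (fun f => esym (Pop2_lapl f))
    (fun f => esym (Pop2_slapl f)) (fun=> erefl)).
  rewrite -lapl_slapl; apply: (congr1 (inner ^~ (delta x))); rewrite /mixop addSn /=.
  by rewrite (iter_commute _ lapl_slaplC).
have := completely_monotone_decay s u0 uS m k.
rewrite [u 0%N k]inner_delta; apply: le_trans.
rewrite Em_smoothed ler_wpM2l ?exprn_ge0//.
rewrite -/(u m (k + k)%N) -(subnKC (_ : (k + m * s <= k + k)%N)) ?leq_add2l//.
elim: (_ - _)%N => [|i]; first by rewrite addn0.
by apply: le_trans; rewrite addnS -subr_ge0 uS.
Qed.

(** Positive energy is what admits the smoothed kernel as a test function in the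
    resolvent metric. *)
Lemma Em_smoothed_gt0 m k x : 0 < smoothed m k x x ->
  0 < Em mu m (smoothed m k x) (smoothed m k x).
Proof.
move=> pos; rewrite lt_def Em_smoothed inner_mixop_ge0 ?andbT; last exact: finsupp_delta.
rewrite -Em_smoothed; apply/eqP => E0; move: pos.
by rewrite (inner_iter_lapl_eq0 (finsupp_smoothed m k x) E0) ltxx.
Qed.

Lemma ell2_finsupp f : finsupp f -> ell2 mu f.
Proof.
move=> [s sf]; rewrite /ell2/= (@esum_supported _ _ s) ?ltry//.
  by move=> x; rewrite mulr_ge0 ?sqr_ge0.
by move=> x /sf ->; rewrite expr0n mul0r.
Qed.

Lemma smoothed_resolvent m k x y (K : R) : 0 <= K -> (Rm mu m x y <= K%:E)%E ->
  0 < smoothed m k x x ->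
  (smoothed m k x x - smoothed m k x y) ^+ 2 <=
    K * Em mu m (smoothed m k x) (smoothed m k x).
Proof.
move=> K0 RK pos; set f := smoothed m k x; have E0 := Em_smoothed_gt0 pos.
have [->|fxy] := eqVneq (f x) (f y).
  by rewrite subrr expr0n mulr_ge0// ltW.
rewrite -ler_pdivrMr// -lee_fin; apply: le_trans RK.
rewrite /Rm ifN; last by apply: contra fxy => /eqP ->.
apply: ereal_sup_ubound; exists f; last by rewrite real_normK ?num_real.
split; last exact/eqP.
by split => //; apply/ell2_finsupp/finsupp_smoothed.
Qed.

(** * From oscillation to volume *)

Lemma mweight_le (A : set T) (c : R) :
  (forall s, [set` s] `<=` A -> \sum_(x <- s) v x <= c) ->
  (mweight mu A <= c%:E)%E.
Proof.
move=> H; apply: ub_ereal_sup => _ [X [/finite_fsetP[s ->] sA] <-].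
by rewrite -(fsbig_seq _ _ (fset_uniq s)) sumEFin lee_fin H.
Qed.

Lemma sum_le_mweight (A : set T) s (c : R) : mweight mu A = c%:E ->
  [set` s] `<=` A -> \sum_(x <- s) v x <= c.
Proof.
move=> Ac sA; rewrite -lee_fin -Ac -sumEFin (fsbig_seq _ _ (fset_uniq s)).
by apply: esum_ge; exists [set` s].
Qed.

Lemma mweight_ge0 (A : set T) : (0 <= mweight mu A)%E.
Proof. by apply: esum_ge0 => x _; rewrite lee_fin. Qed.

(** Dividing [(f x - f y)^2 V <= K f x] by [f x] and dropping [(f y)^2] gives
    [f x V <= 2 V f y + K]; averaging this over [B] bounds the right-hand side
    by twice the total mass of [f] plus [K]. *)
Lemma smoothed_diag_volume_le m k x (B : set T) (V K : R) : 0 <= K ->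
  mweight mu B = V%:E ->
  (0 < smoothed m k x x -> forall y, B y ->
     (smoothed m k x x - smoothed m k x y) ^+ 2 * V <= K * smoothed m k x x) ->
  smoothed m k x x * V <= 2 * 2 ^+ m + K.
Proof.
set f := smoothed m k x => K0 BV osc.
have c0 : 0 <= 2 * 2 ^+ m + K by rewrite addr_ge0// mulr_ge0// exprn_ge0.
have V0 : 0 <= V by rewrite -lee_fin -BV mweight_ge0.
have [->|Vn] := eqVneq V 0; first by rewrite mulr0.
have V_gt0 : 0 < V by rewrite lt_def Vn.
have := smoothed_ge0 m k x x; rewrite -/f le_eqVlt => /orP[/eqP <-|a0].
  by rewrite mul0r.
have pointwise y : B y -> f x * V <= 2 * V * f y + K.
  move=> /(osc a0); rewrite -/f => H.
  suff : f x * (f x * V) <= f x * (2 * V * f y + K) by rewrite ler_pM2l.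
  have : 0 <= f y ^+ 2 * V by rewrite mulr_ge0 ?sqr_ge0.
  by nra.
rewrite -ler_pdivlMl// -lee_fin -BV; apply: mweight_le => s sB.
rewrite ler_pdivlMl// -(ler_pM2l V_gt0).
have sV := sum_le_mweight BV sB.
have sf : \sum_(y <- s) f y * v y <= 2 ^+ m.
  apply: le_trans (mass_smoothed_le m k x); apply: sum_le_mass.
    exact: finsupp_smoothed.
  exact: smoothed_ge0.
apply: (@le_trans _ _ (2 * V * (\sum_(y <- s) f y * v y) + K * \sum_(y <- s) v y)).
  rewrite mulrA (mulrC V) !mulr_sumr -big_split/= big_seq [leRHS]big_seq.
  apply: ler_sum => y ys; rewrite mulrA -mulrDl ler_wpM2r//.
  exact/pointwise/sB.
have := ler_wpM2l K0 sV; have := ler_wpM2l (ltW V_gt0) sf; lra.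
Qed.

End Walk.

(** * The heat kernel bound *)

Lemma Fscale_lt (R : realType) (V : \bar R) (r t : R) (m : nat) :
  (0 < m)%N -> 0 < r -> (0 <= V)%E ->
  (poweR ((r ^+ 2)%:E * V) m%:R^-1 < t%:E)%E ->
  exists2 c, V = c%:E & r ^+ 2 * c < t ^+ m.
Proof.
move=> m0 r0; case: V => [c||]//; last first.
  move=> _; rewrite gt0_muley ?lte_fin ?exprn_gt0// poweRyr//.
  by rewrite invr_eq0 pnatr_eq0 -lt0n.
rewrite lee_fin -EFinM poweR_EFin lte_fin => c0 H; exists c => //.
have rc0 : 0 <= r ^+ 2 * c by rewrite mulr_ge0// sqr_ge0.
have -> : r ^+ 2 * c = ((r ^+ 2 * c) `^ m%:R^-1) ^+ m.
  by rewrite -[RHS]powR_mulrn ?powR_ge0// -powRrM mulVf ?powRr1// pnatr_eq0 -lt0n.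
have t0 : 0 <= t by apply: le_trans (ltW H); apply: powR_ge0.
by rewrite ltr_pXn2r ?nnegrE ?powR_ge0.
Qed.

Lemma leq_half_ceil (n m : nat) :
  (0 < m)%N -> (n <= 2 * m * (n./2 %/ m).+1)%N.
Proof.
move=> m0; rewrite -mulnA [(m * _)%N]mulnC.
have := ltn_ceil n./2 m0; have := odd_double_half n.
by move: (_ * m)%N => q; case: odd; lia.
Qed.

Section Main.
Variables (R : realType) (T : countType) (mu : T -> T -> R).
Variables (m : nat) (rho : T -> T -> R).
Hypotheses (hmu : weighted_graph mu) (hp0 : cond_p0 mu) (hm : (1 <= m)%N).
Hypotheses (hrho : resolvent_metric mu m rho) (hVD : volume_doubling mu rho).

Lemma Brho_lt x r y : Brho mu rho x r y -> rho x y < r.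
Proof. by move=> [p [_ <- H]]; apply: H; apply: mem_last. Qed.

Lemma Vrho_ge0 x r : (0 <= Vrho mu rho x r)%E.
Proof. exact: mweight_ge0. Qed.

(** Settles the case of scale 0, which includes the infimum of an empty set: the
    bound claimed by the theorem is then infinite. *)
Lemma Vrho_le0 x r : r <= 0 -> Vrho mu rho x r = 0%E.
Proof.
case: hrho => -[rho0 _ _ _] _ r0; rewrite /Vrho /mweight.
suff -> : Brho mu rho x r = set0 by rewrite esum_set0.
by rewrite -subset0 => y /Brho_lt/lt_le_trans/(_ r0); rewrite ltNge rho0.
Qed.

(** The finiteness of the volume is obtained on the way: the ball of half the
    scale has finite volume because the scale function is finite there, and
    doubling passes this on. *)
Lemma pn_diag_bound : exists2 C : R, 0 < C & forall x n, (0 < n)%N ->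
  exists2 V, Vrho mu rho x (fscale mu rho m x n%:R) = V%:E &
    pn mu n./2.*2 x x * V <= C.
Proof.
have [[rho0 _ _ _] [c [C [_ _ C1 hR]]]] := hrho; have [Cr Cr0 VD] := hVD.
have C0 : 0 < C by apply: lt_trans C1.
pose K := C * (2 * m)%:R ^+ m.
have K0 : 0 <= K by rewrite mulr_ge0 ?exprn_ge0// ltW.
have D0 : 0 < 2 * 2 ^+ m + K :> R by rewrite ltr_wpDr// mulr_gt0// exprn_gt0.
exists (Cr * (2 * 2 ^+ m + K)) => [|x n n0]; first by rewrite mulr_gt0.
set t := fscale _ _ _ _ _.
have [t0|t0] := leP t 0.
  by exists 0; rewrite ?Vrho_le0// mulr0 mulr_ge0 ?ltW.
(* Half the scale lies strictly below the infimum defining it. *)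
have r0 : 0 < t / 2 by rewrite divr_gt0.
have : (Fscale mu rho m x (t / 2) < n%:R%:E)%E.
  rewrite ltNge; apply/negP => tF.
  suff : t <= t / 2 by rewrite ler_pdivlMr//; lra.
  by apply: ge_inf => //; exists 0 => r [/ltW].
move=> /(Fscale_lt hm r0 (Vrho_ge0 _ _))[V VE rV].
have V0 : 0 <= V by rewrite -lee_fin -VE; apply: Vrho_ge0.
have := VD x _ r0; rewrite mulrCA divff// mulr1 VE -EFinM => VD'.
have W0 := Vrho_ge0 x t.
have Wfin : Vrho mu rho x t \is a fin_num.
  by rewrite ge0_fin_numE// (le_lt_trans VD')// ltry.
exists (fine (Vrho mu rho x t)); first by rewrite fineK.
rewrite -(fineK Wfin) lee_fin in VD'.
pose k := n./2; pose a := smoothed mu m k x x.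
have a0 : 0 <= a by apply: smoothed_ge0.
have pa : pn mu k.*2 x x <= a by apply: smoothed_ge_pn.
apply: le_trans (_ : a * (Cr * V) <= _).
  by apply: ler_pM => //; [exact: pn_ge0|exact: fine_ge0].
rewrite mulrCA ler_pM2l//.
apply: (smoothed_diag_volume_le hmu hp0 K0 VE) => a_gt0 y /Brho_lt xy.
rewrite -/a in a_gt0 *.
pose E := Em mu m (smoothed mu m k x) (smoothed mu m k x).
have E0 : 0 < E by apply: Em_smoothed_gt0.
have Rxy : (Rm mu m x y <= (C * (t / 2) ^+ 2)%:E)%E.
  apply: le_trans (hR x y).2 _; rewrite lee_fin ler_pM2l//.
  by rewrite ler_pXn2r ?nnegrE// ltW.
have CR0 : 0 <= C * (t / 2) ^+ 2 by rewrite mulr_ge0 ?sqr_ge0// ltW.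
have osc := smoothed_resolvent hmu hp0 CR0 Rxy a_gt0.
apply: le_trans (ler_wpM2r V0 osc) _; rewrite -/E.
have -> : C * (t / 2) ^+ 2 * E * V = C * E * ((t / 2) ^+ 2 * V) by ring.
apply: le_trans (_ : C * E * n%:R ^+ m <= _).
  by apply: ler_wpM2l; [rewrite mulr_ge0 ?ltW|exact: ltW].
rewrite /K -!mulrA ler_pM2l//.
(* The time from k to 2k is cut into m steps of length k %/ m; each spans
   k %/ m + 1 integers, which absorbs the rounding in n./2 and k %/ m. *)
have ds : (m * (k %/ m) <= k)%N by rewrite mulnC leq_divM.
have := Em_smoothed_decay hmu hp0 x ds; rewrite -/E -/a => dec.
apply: le_trans (ler_wpM2l (exprn_ge0 m (ler0n R (2 * m))) dec).
rewrite mulrA -exprMn mulrC ler_pM2r// lerXn2r ?nnegrE// -natrM ler_nat.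
exact: leq_half_ceil.
Qed.
End Main.

Lemma le_div_sqrte (R : realType) (p V W C : R) : 0 <= p -> 0 < C ->
  0 <= V -> 0 <= W -> p ^+ 2 * (V * W) <= C ^+ 2 ->
  (p%:E <= C%:E / sqrte (V%:E * W%:E))%E.
Proof.
move=> p0 C0 V0 W0 H; rewrite -EFinM /=.
have c0 : 0 <= V * W by rewrite mulr_ge0.
have [->|c_neq0] := eqVneq (V * W) 0.
  by rewrite sqrtr0 inve0 gt0_muley ?lte_fin// leey.
have sc0 : 0 < Num.sqrt (V * W) by rewrite sqrtr_gt0 lt_def c_neq0.
rewrite inver gt_eqF// -EFinM lee_fin ler_pdivlMr//.
by rewrite -(@ler_pXn2r _ 2) ?nnegrE ?mulr_ge0 ?sqrtr_ge0 ?(ltW C0)// exprMn sqr_sqrtr.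
Qed.

Theorem theorem5p1 (R : realType) (T : countType) (mu : T -> T -> R)
    (m : nat) (rho : T -> T -> R)
    (hmu : weighted_graph mu)
    (hp0 : cond_p0 mu)
    (hm : (1 <= m)%N)
    (hRm : forall x y, (Rm mu m x y < +oo)%E)
    (hrho : resolvent_metric mu m rho)
    (hVD : volume_doubling mu rho) :
  exists C : R, 0 < C /\
    forall (x y : T) (n : nat), (0 < n)%N ->
      ((pn mu n x x)%:E <= C%:E / Vrho mu rho x (fscale mu rho m x n%:R))%E /\
      ((pn mu n x y)%:E <=
         C%:E / sqrte (Vrho mu rho x (fscale mu rho m x n%:R) *
                       Vrho mu rho y (fscale mu rho m y n%:R)))%E.
Proof.
have [C C0 H] := pn_diag_bound hmu hp0 hm hrho hVD.
have main x y n : (0 < n)%N -> ((pn mu n x y)%:E <=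
         C%:E / sqrte (Vrho mu rho x (fscale mu rho m x n%:R) *
                       Vrho mu rho y (fscale mu rho m y n%:R)))%E.
  move=> n0; have [V VE pV] := H x n n0; have [W WE pW] := H y n n0.
  have V0 : 0 <= V by rewrite -lee_fin -VE; apply: mweight_ge0.
  have W0 : 0 <= W by rewrite -lee_fin -WE; apply: mweight_ge0.
  rewrite VE WE; apply: le_div_sqrte => //; first exact: pn_ge0.
  apply: le_trans (ler_wpM2r (mulr_ge0 V0 W0) (pn_le_diag hmu hp0 n x y)) _.
  by rewrite mulrACA expr2; apply: ler_pM => //; apply: mulr_ge0 => //; apply: pn_ge0.
exists C; split => // x y n n0; split; last exact: main.
have := main x x n n0; rewrite -expe2 sqrte_sqr gee0_abs//.
exact: mweight_ge0.
Qed.
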